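(* The theory of the structure $\langle\mathbb{R}^{\geqslant 0},0,1,\cdot,{}^{-1}\rangle$ admits quantifier elimination.
   Context: $\mathbb{R}^{\geqslant 0}$ is the set of nonnegative real numbers with constants $0,1$, ordinary multiplication, and ${}^{-1}$ given by $x^{-1}=1/x$ for $x\neq 0$ and $0^{-1}=0$. *)

(* Defs.v *)
From mathcomp Require Import all_boot all_order all_algebra.
From mathcomp Require Import reals.

Set Implicit Arguments.
Unset Strict Implicit.
Unset Printing Implicit Defensive.

Import Order.TTheory GRing.Theory Num.Theory.
Local Open Scope ring_scope.

(* First-order logic with equality over the signature (0, 1, ., ^-1);         *)
(* variables are named by natural numbers.                                    *)

Inductive term : Type :=
| TVar of nat
| TZero
| TOne
| TMul of term & term
| TInv of term.

Inductive formula : Type :=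
| FFalse
| FEq of term & term
| FNot of formula
| FAnd of formula & formula
| FOr of formula & formula
| FImp of formula & formula
| FAll of nat & formula
| FEx of nat & formula.

Definition FIff (p q : formula) : formula := FAnd (FImp p q) (FImp q p).

Fixpoint term_vars (t : term) : seq nat :=
  match t with
  | TVar n => [:: n]
  | TZero | TOne => [::]
  | TMul t u => term_vars t ++ term_vars u
  | TInv t => term_vars t
  end.

Fixpoint free_vars (p : formula) : seq nat :=
  match p with
  | FFalse => [::]
  | FEq t u => term_vars t ++ term_vars u
  | FNot p => free_vars p
  | FAnd p q | FOr p q | FImp p q => free_vars p ++ free_vars q
  | FAll n p | FEx n p => [seq m <- free_vars p | m != n]
  end.

Definition sentence (p : formula) : Prop := free_vars p = [::].

Fixpoint quantifier_free (p : formula) : bool :=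
  match p with
  | FFalse | FEq _ _ => true
  | FNot p => quantifier_free p
  | FAnd p q | FOr p q | FImp p q => quantifier_free p && quantifier_free q
  | FAll _ _ | FEx _ _ => false
  end.

(* The carrier is automatically nonempty, as it interprets the constants. *)
Record structure : Type := Structure {
  carrier :> Type;
  zero_ : carrier;
  one_ : carrier;
  mul_ : carrier -> carrier -> carrier;
  inv_ : carrier -> carrier
}.

Definition update (T : Type) (s : nat -> T) (n : nat) (a : T) : nat -> T :=
  fun m => if m == n then a else s m.

Fixpoint eval (M : structure) (s : nat -> M) (t : term) : M :=
  match t with
  | TVar n => s n
  | TZero => zero_ M
  | TOne => one_ M
  | TMul t u => mul_ (eval s t) (eval s u)
  | TInv t => inv_ (eval s t)
  end.

Fixpoint holds (M : structure) (s : nat -> M) (p : formula) : Prop :=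
  match p with
  | FFalse => False
  | FEq t u => eval s t = eval s u
  | FNot p => ~ holds s p
  | FAnd p q => holds s p /\ holds s q
  | FOr p q => holds s p \/ holds s q
  | FImp p q => holds s p -> holds s q
  | FAll n p => forall a : M, holds (update s n a) p
  | FEx n p => exists a : M, holds (update s n a) p
  end.

Definition satisfies (M : structure) (p : formula) : Prop :=
  forall s : nat -> M, holds s p.

Definition theory_of (M : structure) : formula -> Prop :=
  fun p => sentence p /\ satisfies M p.

Definition model_of (T : formula -> Prop) (M : structure) : Prop :=
  forall p : formula, T p -> satisfies M p.

Definition entails (T : formula -> Prop) (p : formula) : Prop :=
  forall M : structure, model_of T M -> satisfies M p.

Definition admits_quantifier_elimination (T : formula -> Prop) : Prop :=
  forall p : formula, exists q : formula,
    [/\ quantifier_free q,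
        {subset free_vars q <= free_vars p}
      & entails T (FIff p q)].

Section NonnegativeReals.
Variable R : realType.

Definition nnreal : Type := {x : R | 0 <= x}.

Definition nnreal0 : nnreal := exist _ 0 (lexx 0).

Definition nnreal1 : nnreal := exist _ 1 ler01.

Definition nnreal_mul (x y : nnreal) : nnreal :=
  exist _ (val x * val y) (mulr_ge0 (valP x) (valP y)).

Lemma nnreal_inv_subproof (x : nnreal) : 0 <= (val x)^-1.
Proof. by rewrite invr_ge0 (valP x). Qed.

Definition nnreal_inv (x : nnreal) : nnreal :=
  exist _ (val x)^-1 (nnreal_inv_subproof x).

(* The inverse of a field is total, with the required value at 0. *)
Lemma val_nnreal_inv (x : nnreal) :
  val (nnreal_inv x) = if val x == 0 then 0 else 1 / val x.
Proof. by rewrite /= div1r; case: eqP => // ->; rewrite invr0. Qed.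

Definition nnreal_structure : structure :=
  Structure nnreal0 nnreal1 nnreal_mul nnreal_inv.

End NonnegativeReals.

(* Main.v *)
From HB Require Import structures.
Require Import Defs.
From mathcomp Require Import all_boot all_order all_algebra.
From mathcomp Require Import boolp reals exp.

Set Implicit Arguments.
Unset Strict Implicit.
Unset Printing Implicit Defensive.

Import Order.TTheory GRing.Theory Num.Theory.
Local Open Scope ring_scope.

(** An equivalence valid in a structure holds in all models of its theory,
    because its universal closure does.  So it suffices to find, for [p]
    quantifier-free, a quantifier-free equivalent of [FEx x p] in the
    nonnegative reals.  For [x != 0] every atom can be written [x ^ d * P = Q]
    with [d] an integer and [P], [Q] free of [x].  If [d != 0], it holds at
    every point when [P = Q = 0], and otherwise at most at the unique root of
    [x ^ d = Q / P].  So [p] has a solution iff it holds at [0], or at one of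
    these roots, or at a generic point, where the atoms with [d != 0] hold only
    if [P = Q = 0].  At the root of [x ^ d = w] the truth of an atom is found by
    raising both sides to the power [d], which is injective and turns [x ^ e]
    into [w ^ e].  Only the existence and uniqueness of roots is used, and that
    there are infinitely many points. *)

(** * Reduction to eliminating one quantifier in one structure *)

Definition universal_closure (p : formula) : formula :=
  foldr FAll p (free_vars p).

Lemma free_vars_FAlls l p :
  free_vars (foldr FAll p l) = [seq m <- free_vars p | m \notin l].
Proof.
elim: l => [|n l IH] /=; first by rewrite filter_predT.
by rewrite IH -filter_predI; apply: eq_filter => m; rewrite /= inE negb_or.
Qed.

Lemma sentence_universal_closure p : sentence (universal_closure p).
Proof.
rewrite /sentence free_vars_FAlls -(filter_pred0 (free_vars p)).
by apply: eq_in_filter => m /= ->.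
Qed.

Lemma update_id (T : Type) (s : nat -> T) n : update s n (s n) = s.
Proof. by apply/funext => m; rewrite /update; case: eqP => [->|]. Qed.

Lemma satisfies_FAlls (M : structure) l p :
  satisfies M (foldr FAll p l) <-> satisfies M p.
Proof.
elim: l => //= n l <-; split=> holds_all s; last by move=> a; apply: holds_all.
by rewrite -(update_id s n); apply: holds_all.
Qed.

Lemma entails_theory_of (M : structure) p :
  satisfies M p -> entails (theory_of M) p.
Proof.
move=> Mp N NT; apply/(satisfies_FAlls _ (free_vars p)).
apply: NT; split; first exact: sentence_universal_closure.
exact/satisfies_FAlls.
Qed.

Definition qf_definable (M : structure) (p : formula) : Prop :=
  exists q : formula,
    [/\ quantifier_free q,
        {subset free_vars q <= free_vars p}
      & forall s : nat -> M, holds s p <-> holds s q].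

Lemma theory_of_qe (M : structure) :
  (forall p, qf_definable M p) ->
  admits_quantifier_elimination (theory_of M).
Proof.
move=> qfM p; have [q [qfq sqp pq]] := qfM p.
by exists q; split=> //; apply: entails_theory_of.
Qed.

Lemma sub_free_vars_FEx x p q :
  {subset free_vars q <= free_vars p} ->
  {subset free_vars (FEx x q) <= free_vars (FEx x p)}.
Proof. by move=> sqp m; rewrite !mem_filter => /andP[-> /sqp]. Qed.

Lemma sub_cat (T : eqType) (s1 s2 t1 t2 : seq T) :
  {subset s1 <= t1} -> {subset s2 <= t2} -> {subset s1 ++ s2 <= t1 ++ t2}.
Proof.
by move=> s12 t12 m; rewrite !mem_cat => /orP[/s12|/t12] ->; rewrite ?orbT.
Qed.

Lemma qf_definable_from_FEx (M : structure) :
  (forall x p, quantifier_free p -> qf_definable M (FEx x p)) ->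
  forall p, qf_definable M p.
Proof.
move=> elimEx.
elim=> [|t u|p [p' [qfp sp pp']]|p [p' [qfp sp pp']] q [q' [qfq sq qq']]
  |p [p' [qfp sp pp']] q [q' [qfq sq qq']]
  |p [p' [qfp sp pp']] q [q' [qfq sq qq']]
  |n p [p' [qfp sp pp']]|n p [p' [qfp sp pp']]].
- by exists FFalse; split=> // s; split.
- by exists (FEq t u); split=> // s; split.
- by exists (FNot p'); split=> // s; have := pp' s => /=; tauto.
- exists (FAnd p' q'); split; [by rewrite /= qfp | exact: sub_cat |].
  by move=> s; have := pp' s; have := qq' s => /=; tauto.
- exists (FOr p' q'); split; [by rewrite /= qfp | exact: sub_cat |].
  by move=> s; have := pp' s; have := qq' s => /=; tauto.
- exists (FImp p' q'); split; [by rewrite /= qfp | exact: sub_cat |].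
  by move=> s; have := pp' s; have := qq' s => /=; tauto.
- have [r [qfr sr pr]] := elimEx n (FNot p') qfp; exists (FNot r); split=> //.
    by move=> m /sr; apply: (@sub_free_vars_FEx n p (FNot p')).
  move=> s; split=> [allp /pr[a]|nr a]; first by apply; apply/pp'.
  by apply: contrapT => np; apply/nr/pr; exists a => /pp'.
- have [r [qfr sr pr]] := elimEx n p' qfp; exists r; split=> //.
    by move=> m /sr; apply: sub_free_vars_FEx.
  by move=> s; rewrite -pr; split=> -[a pa]; exists a; apply/pp'.
Qed.

(** * Atoms of formulas *)

HB.instance Definition _ := gen_eqMixin term.

Definition FAtom (a : term * term) : formula := FEq a.1 a.2.

Fixpoint atoms (p : formula) : seq (term * term) :=
  match p with
  | FFalse => [::]
  | FEq t u => [:: (t, u)]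
  | FNot p | FAll _ p | FEx _ p => atoms p
  | FAnd p q | FOr p q | FImp p q => atoms p ++ atoms q
  end.

Fixpoint map_atoms (f : term * term -> formula) (p : formula) : formula :=
  match p with
  | FFalse => FFalse
  | FEq t u => f (t, u)
  | FNot p => FNot (map_atoms f p)
  | FAnd p q => FAnd (map_atoms f p) (map_atoms f q)
  | FOr p q => FOr (map_atoms f p) (map_atoms f q)
  | FImp p q => FImp (map_atoms f p) (map_atoms f q)
  | FAll n p => FAll n (map_atoms f p)
  | FEx n p => FEx n (map_atoms f p)
  end.

Lemma map_FAtom p : map_atoms FAtom p = p.
Proof.
by elim: p => //= [p ->|p -> q ->|p -> q ->|p -> q ->|n p ->|n p ->].
Qed.

Lemma quantifier_free_map_atoms f p : (forall a, quantifier_free (f a)) ->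
  quantifier_free (map_atoms f p) = quantifier_free p.
Proof.
by move=> qff; elim: p => //= [t u|p -> q ->|p -> q ->|p -> q ->];
  rewrite ?qff.
Qed.

Lemma free_vars_map_atoms f p : quantifier_free p ->
  free_vars (map_atoms f p) = flatten [seq free_vars (f a) | a <- atoms p].
Proof.
elim: p => //= [t u _|p IHp q IHq|p IHp q IHq|p IHp q IHq].
  by rewrite cats0.
all: by case/andP=> /IHp -> /IHq ->; rewrite map_cat flatten_cat.
Qed.

Lemma sub_free_vars_map_atoms f p (V : seq nat) : quantifier_free p ->
  {in atoms p, forall a, {subset free_vars (f a) <= V}} ->
  {subset free_vars (map_atoms f p) <= V}.
Proof.
move=> qfp fV m; rewrite free_vars_map_atoms //.
by case/flatten_mapP => a /fV; apply.
Qed.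

Lemma sub_free_vars_FAtom p a : quantifier_free p -> a \in atoms p ->
  {subset free_vars (FAtom a) <= free_vars p}.
Proof.
move=> qfp ap m ma; rewrite -{1}(map_FAtom p) free_vars_map_atoms //.
by apply/flatten_mapP; exists a.
Qed.

Lemma holds_map_atoms (M : structure) (s s' : nat -> M) f p :
  quantifier_free p ->
  {in atoms p, forall a, holds s (f a) <-> holds s' (FAtom a)} ->
  holds s (map_atoms f p) <-> holds s' p.
Proof.
elim: p => //= [t u|p IHp|p IHp q IHq|p IHp q IHq|p IHp q IHq].
- by move=> _; apply; rewrite mem_head.
- by move=> qfp fP; have := IHp qfp fP; tauto.
all: case/andP=> qfp qfq fP.
all: have {}IHp : holds s (map_atoms f p) <-> holds s' p
  by apply: IHp => // a ap; apply: fP; rewrite mem_cat ap.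
all: have {}IHq : holds s (map_atoms f q) <-> holds s' q
  by apply: IHq => // a aq; apply: fP; rewrite mem_cat aq orbT.
all: tauto.
Qed.

Definition FOrs (T : Type) (F : T -> formula) (l : seq T) : formula :=
  foldr (fun a => FOr (F a)) FFalse l.

Lemma quantifier_free_FOrs T (F : T -> formula) l :
  quantifier_free (FOrs F l) = all (fun a => quantifier_free (F a)) l.
Proof. by elim: l => //= a l ->. Qed.

Lemma free_vars_FOrs T (F : T -> formula) l :
  free_vars (FOrs F l) = flatten [seq free_vars (F a) | a <- l].
Proof. by elim: l => //= a l ->. Qed.

Lemma holds_FOrs (M : structure) (s : nat -> M) (T : eqType)
    (F : T -> formula) l :
  holds s (FOrs F l) <-> exists2 a, a \in l & holds s (F a).
Proof.
elim: l => [|b l IH] /=; first by split=> // -[].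
split=> [[Fb|/IH[a al Fa]]|[a]].
- by exists b; rewrite ?mem_head.
- by exists a; rewrite // inE al orbT.
- by rewrite inE => /predU1P[-> ?|al Fa]; [left | right; apply/IH; exists a].
Qed.

(** * Separating a variable in a term *)

Fixpoint exponent (x : nat) (t : term) : int :=
  match t with
  | TVar y => (y == x)%:Z
  | TZero | TOne => 0
  | TMul t u => exponent x t + exponent x u
  | TInv t => - exponent x t
  end.

Fixpoint subst (x : nat) (r t : term) : term :=
  match t with
  | TVar y => if y == x then r else TVar y
  | TZero => TZero
  | TOne => TOne
  | TMul t u => TMul (subst x r t) (subst x r u)
  | TInv t => TInv (subst x r t)
  end.

Definition coef (x : nat) (t : term) : term := subst x TOne t.

Definition TExp (t : term) (d : int) : term :=
  match d with
  | Posz n => iter n (TMul t) TOne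
  | Negz n => TInv (iter n.+1 (TMul t) TOne)
  end.

Lemma eval_subst (M : structure) (s : nat -> M) x r t :
  eval s (subst x r t) = eval (update s x (eval s r)) t.
Proof.
by elim: t => //= [y|t -> u ->|t ->] //; rewrite /update; case: eqP.
Qed.

Lemma term_vars_subst x r t : term_vars r = [::] ->
  term_vars (subst x r t) = [seq m <- term_vars t | m != x].
Proof.
by move=> r0; elim: t => //= [y|t -> u ->]; [case: eqP | rewrite filter_cat].
Qed.

Lemma term_vars_TExp t d : {subset term_vars (TExp t d) <= term_vars t}.
Proof.
have iterP n : {subset term_vars (iter n (TMul t) TOne) <= term_vars t}.
  by elim: n => //= n IH m; rewrite mem_cat => /orP[|/IH].
by case: d => n; [exact: iterP | exact: (iterP n.+1)].
Qed.

(** * The elimination formula *)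

(* For [x != 0] and nonzero coefficients, the atom [a] says that
   [x ^ root_order x a = radicand x a]. *)
Definition root_order (x : nat) (a : term * term) : int :=
  exponent x a.1 - exponent x a.2.

Definition radicand (x : nat) (a : term * term) : term :=
  TMul (coef x a.2) (TInv (coef x a.1)).

Definition atom_at_zero (x : nat) (a : term * term) : formula :=
  FEq (subst x TZero a.1) (subst x TZero a.2).

Definition atom_at_generic (x : nat) (a : term * term) : formula :=
  if root_order x a == 0 then FEq (coef x a.1) (coef x a.2)
  else FAnd (FEq (coef x a.1) TZero) (FEq (coef x a.2) TZero).

(* The value of [t ^ d] at a root of [x ^ d = w]. *)
Definition power_at_root (x : nat) (d : int) (w t : term) : term :=
  TMul (TExp w (exponent x t)) (TExp (coef x t) d).

Definition atom_at_root (x : nat) (d : int) (w : term) (a : term * term) :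
    formula :=
  FEq (power_at_root x d w a.1) (power_at_root x d w a.2).

Definition root_atoms (x : nat) (p : formula) : seq (term * term) :=
  [seq a <- atoms p | root_order x a != 0].

Lemma all_root_order x p : all (fun a => root_order x a != 0) (root_atoms x p).
Proof. exact: filter_all. Qed.

Definition formula_at_root (x : nat) (p : formula) (a : term * term) :
    formula :=
  FAnd (FNot (FEq (radicand x a) TZero))
       (map_atoms (atom_at_root x (root_order x a) (radicand x a)) p).

Definition elim_ex (x : nat) (p : formula) : formula :=
  FOr (map_atoms (atom_at_zero x) p)
      (FOr (map_atoms (atom_at_generic x) p)
           (FOrs (formula_at_root x p) (root_atoms x p))).

Lemma quantifier_free_elim_ex x p :
  quantifier_free p -> quantifier_free (elim_ex x p).
Proof.
move=> qfp /=; rewrite quantifier_free_FOrs !quantifier_free_map_atoms ?qfp //.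
  by apply/allP => a _ /=; rewrite quantifier_free_map_atoms.
by move=> a; rewrite /atom_at_generic; case: ifP.
Qed.

Lemma free_vars_atom_at_zero x a :
  free_vars (atom_at_zero x a) = free_vars (FEx x (FAtom a)).
Proof. by rewrite /= !term_vars_subst // filter_cat. Qed.

Lemma free_vars_atom_at_generic x a :
  free_vars (atom_at_generic x a) = free_vars (FEx x (FAtom a)).
Proof.
by rewrite /atom_at_generic; case: ifP => _;
  rewrite /= ?cats0 !term_vars_subst // filter_cat.
Qed.

Lemma sub_term_vars_radicand x a :
  {subset term_vars (radicand x a) <= free_vars (FEx x (FAtom a))}.
Proof.
by move=> m; rewrite /= !term_vars_subst // filter_cat !mem_cat orbC.
Qed.

Lemma sub_free_vars_atom_at_root x d w a :
  {subset free_vars (atom_at_root x d w a)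
     <= term_vars w ++ free_vars (FEx x (FAtom a))}.
Proof.
have power_vars t : {subset term_vars (power_at_root x d w t)
    <= term_vars w ++ [seq m <- term_vars t | m != x]}.
  by rewrite -(term_vars_subst x t (r := TOne)) //; apply: sub_cat;
    apply: term_vars_TExp.
by move=> m /=; rewrite filter_cat mem_cat => /orP[] /power_vars;
  rewrite !mem_cat => /orP[] ->; rewrite ?orbT.
Qed.

Lemma sub_free_vars_elim_ex x p : quantifier_free p ->
  {subset free_vars (elim_ex x p) <= free_vars (FEx x p)}.
Proof.
move=> qfp; have sub_atom a : a \in atoms p ->
    {subset free_vars (FEx x (FAtom a)) <= free_vars (FEx x p)}.
  by move=> ap; apply: sub_free_vars_FEx; apply: sub_free_vars_FAtom.
move=> m; rewrite ![free_vars (elim_ex x p)]/= !mem_cat => /or3P[].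
- apply: sub_free_vars_map_atoms => // a.
  by rewrite free_vars_atom_at_zero => /sub_atom.
- apply: sub_free_vars_map_atoms => // a.
  by rewrite free_vars_atom_at_generic => /sub_atom.
rewrite free_vars_FOrs => /flatten_mapP[a]; rewrite mem_filter => /andP[_ ap].
have sub_radicand : {subset term_vars (radicand x a) <= free_vars (FEx x p)}.
  by move=> k /sub_term_vars_radicand; apply: sub_atom.
rewrite ![free_vars (formula_at_root x p a)]/= cats0 mem_cat.
case/orP=> [/sub_radicand //|].
apply: sub_free_vars_map_atoms => // b bp k /sub_free_vars_atom_at_root.
by rewrite mem_cat => /orP[/sub_radicand|/(sub_atom b bp)].
Qed.

Lemma holds_map_atoms_at_zero (M : structure) (s : nat -> M) x p :
  quantifier_free p ->
  holds s (map_atoms (atom_at_zero x) p) <-> holds (update s x (zero_ M)) p.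
Proof.
by move=> qfp; apply: holds_map_atoms => // a _; rewrite /= !eval_subst.
Qed.

(** * Structures embedded in a field and closed under unique roots *)

Section UniqueRoots.
Variables (F : fieldType) (M : structure) (emb : M -> F).
Hypothesis emb0 : emb (zero_ M) = 0.
Hypothesis emb1 : emb (one_ M) = 1.
Hypothesis embM : {morph emb : c d / mul_ c d >-> c * d}.
Hypothesis embV : {morph emb : c / inv_ c >-> c^-1}.
Hypothesis exprz_inj : forall d : int, d != 0 -> injective (fun c => emb c ^ d).
Hypothesis exists_root :
  forall (d : int) (w : M), d != 0 -> exists c, emb c ^ d = emb w.
(* Excludes [{0, 1}], which has unique roots but no generic point. *)
Hypothesis emb_infinite : forall l : seq F, exists c, emb c \notin l.
Implicit Types (s : nat -> M) (x : nat) (c : M) (a : term * term) (p : formula).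

Lemma emb_inj : injective emb.
Proof. exact: (exprz_inj (oner_neq0 int)). Qed.

Lemma emb_TExp s t d : emb (eval s (TExp t d)) = emb (eval s t) ^ d.
Proof.
have iterE n : emb (eval s (iter n (TMul t) TOne)) = emb (eval s t) ^+ n.
  by elim: n => //= n IH; rewrite embM IH exprS.
by case: d => n; [exact: iterE | rewrite NegzE -exprnN -iterE -embV].
Qed.

Lemma emb_eval_update s x c t : emb c != 0 ->
  emb (eval (update s x c) t) =
  emb c ^ exponent x t * emb (eval s (coef x t)).
Proof.
move=> c0; elim: t => [y|||t IHt u IHu|t IHt] /=.
- rewrite /update /coef /=; case: eqP => _ /=; last by rewrite mul1r.
  by rewrite emb1 mulr1.
- by rewrite emb0 mulr0.
- by rewrite mul1r.
- by rewrite !embM IHt IHu expfzDr // mulrACA.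
- by rewrite !embV IHt invfM invr_expz.
Qed.

Lemma holds_atom_update s x c a : emb c != 0 ->
  holds (update s x c) (FAtom a) <->
  emb c ^ root_order x a * emb (eval s (coef x a.1)) =
  emb (eval s (coef x a.2)).
Proof.
move=> c0; have cn0 d : emb c ^ d != 0 by rewrite expfz_eq0 negb_and c0 orbT.
transitivity (emb (eval (update s x c) a.1) = emb (eval (update s x c) a.2)).
  by split=> [->|/emb_inj].
rewrite !emb_eval_update // expfzDr // -invr_expz mulrAC.
by split=> [->|<-]; [rewrite mulrC mulKf | rewrite mulrCA mulfV ?mulr1].
Qed.

Definition is_root s x c a : bool :=
  emb c ^ root_order x a == emb (eval s (radicand x a)).

Lemma holds_atom_at_generic s x c a : emb c != 0 ->
  (root_order x a != 0 -> ~~ is_root s x c a) ->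
  holds s (atom_at_generic x a) <-> holds (update s x c) (FAtom a).
Proof.
move=> c0; rewrite holds_atom_update // /is_root /= embM embV.
have embE b d : b = d <-> emb b = emb d by split=> [->|/emb_inj].
rewrite /atom_at_generic; case: eqP => [->|_ /(_ isT)] /=.
  by rewrite mul1r embE.
rewrite !embE emb0 => not_root.
split=> [[-> ->]|atom_c]; first by rewrite mulr0.
have [P0|P0] := eqVneq (emb (eval s (coef x a.1))) 0.
  by rewrite -atom_c P0 mulr0.
by rewrite -atom_c mulfK ?eqxx in not_root.
Qed.

Lemma emb_power_at_root s x d w c t : emb c != 0 ->
  emb c ^ d = emb (eval s w) ->
  emb (eval s (power_at_root x d w t)) = emb (eval (update s x c) t) ^ d.
Proof.
move=> c0 cw; rewrite emb_eval_update // expfzMl /= embM !emb_TExp -cw.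
by rewrite !exprz_exp mulrC [d * _]mulrC mulrC.
Qed.

Lemma holds_atom_at_root s x d w c a : d != 0 -> emb c != 0 ->
  emb c ^ d = emb (eval s w) ->
  holds s (atom_at_root x d w a) <-> holds (update s x c) (FAtom a).
Proof.
move=> d0 c0 cw; split=> /= [/(congr1 emb)|Ea].
  by rewrite !(emb_power_at_root _ _ c0 cw) => /(exprz_inj d0).
by apply: emb_inj; rewrite !(emb_power_at_root _ _ c0 cw) Ea.
Qed.

Lemma holds_map_atoms_at_generic s x c p : quantifier_free p -> emb c != 0 ->
  ~~ has (is_root s x c) (root_atoms x p) ->
  holds s (map_atoms (atom_at_generic x) p) <-> holds (update s x c) p.
Proof.
move=> qfp c0 /hasPn not_root; apply: holds_map_atoms => // a ap.
apply: holds_atom_at_generic => // d0.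
by apply: not_root; rewrite mem_filter d0.
Qed.

Lemma holds_formula_at_root s x c a p : quantifier_free p -> emb c != 0 ->
  root_order x a != 0 -> is_root s x c a ->
  holds s (formula_at_root x p a) <-> holds (update s x c) p.
Proof.
move=> qfp c0 d0 /eqP root_c.
have <- : holds s (map_atoms (atom_at_root x (root_order x a) (radicand x a)) p)
    <-> holds (update s x c) p.
  by apply: holds_map_atoms => // b _; apply: holds_atom_at_root d0 c0 root_c.
split=> [[]//|holds_p]; split=> // w0; move/eqP: root_c.
rewrite (w0 : eval s (radicand x a) = zero_ M) emb0.
by rewrite expfz_eq0 (negPf c0) andbF.
Qed.

Lemma exists_non_root s x (l : seq (term * term)) (bad : seq F) :
  all (fun a => root_order x a != 0) l ->
  exists2 c, emb c \notin bad & ~~ has (is_root s x c) l.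
Proof.
elim: l bad => [|a l IH] bad /=.
  by have [c] := emb_infinite bad; exists c.
case/andP=> d0 l0.
have [r root_r] := exists_root (eval s (radicand x a)) d0.
have [c] := IH (emb r :: bad) l0.
rewrite inE negb_or => /andP[cr cbad] not_root; exists c => //=.
rewrite negb_or not_root andbT; apply: contra cr => /eqP root_c.
by apply/eqP; congr emb; apply: (exprz_inj d0); rewrite root_c.
Qed.

Lemma elim_ex_sound s x p : quantifier_free p ->
  holds s (elim_ex x p) -> exists c, holds (update s x c) p.
Proof.
move=> qfp [at_zero|[at_generic|/holds_FOrs[a]]].
- by exists (zero_ M); apply/holds_map_atoms_at_zero.
- have [c] := exists_non_root s [:: 0] (all_root_order x p).
  rewrite inE => c0 not_root.
  by exists c; apply/(holds_map_atoms_at_generic qfp c0 not_root).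
rewrite mem_filter => /andP[d0 _] at_root.
have [c root_c] := exists_root (eval s (radicand x a)) d0.
have c0 : emb c != 0.
  have [w0 _] := at_root; apply/eqP => c0; apply: w0; apply: emb_inj.
  by rewrite -root_c c0 exp0rz (negPf d0) /= emb0.
exists c; move: at_root.
by rewrite (holds_formula_at_root qfp c0 d0) // /is_root root_c.
Qed.

Lemma elim_ex_complete s x c p : quantifier_free p ->
  holds (update s x c) p -> holds s (elim_ex x p).
Proof.
move=> qfp holds_p; have [c0|c0] := eqVneq (emb c) 0.
  left; apply/holds_map_atoms_at_zero => //.
  by have <- : c = zero_ M by apply: emb_inj; rewrite c0.
right; have [/hasP[a ap root_c]|not_root] :=
    boolP (has (is_root s x c) (root_atoms x p)).
  right; apply/holds_FOrs; exists a => //.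
  have d0 := allP (all_root_order x p) a ap.
  exact/(holds_formula_at_root qfp c0 d0 root_c).
by left; apply/(holds_map_atoms_at_generic qfp c0 not_root).
Qed.

Lemma unique_roots_qe : admits_quantifier_elimination (theory_of M).
Proof.
apply/theory_of_qe/qf_definable_from_FEx => x p qfp.
exists (elim_ex x p); split.
- exact: quantifier_free_elim_ex.
- exact: sub_free_vars_elim_ex.
- by move=> s; split=> [[c]|]; [apply: elim_ex_complete | apply: elim_ex_sound].
Qed.

End UniqueRoots.

Lemma powR_root (R : realType) (d : int) (w : R) : d != 0 -> 0 <= w ->
  (w `^ (d%:~R)^-1) ^ d = w.
Proof.
move=> d0 w0; rewrite -powR_intmul ?powR_ge0 // -powRrM mulVf ?intr_eq0 //.
exact: powRr1.
Qed.

Lemma exists_nonneg_notin (R : realDomainType) (l : seq R) :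
  exists2 b : R, 0 <= b & b \notin l.
Proof.
pose b := \big[Order.max/0]_(y <- l) y + 1.
have lt_b y : y \in l -> y < b.
  by move=> yl; rewrite ltr_pwDr // (le_bigmax_seq 0 y predT id).
exists b; last by apply/negP => /lt_b; rewrite ltxx.
by rewrite addr_ge0 // bigmax_ge_id.
Qed.

Theorem theorem8 (R : realType) :
  admits_quantifier_elimination (theory_of (nnreal_structure R)).
Proof.
apply: (@unique_roots_qe R (nnreal_structure R) val) => //.
- by move=> d d0 b c /(pexpIrz d0 (valP b) (valP c)) /val_inj.
- move=> d w d0.
  exists (Sub (val w `^ d%:~R^-1) (powR_ge0 _ _) : nnreal R).
  exact: powR_root (valP w).
- move=> l; have [b b0 bl] := exists_nonneg_notin l.
  by exists (Sub b b0 : nnreal R).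
Qed.
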